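(* Let $A_1,A_2,A_3,B_1,B_2,B_3\in\mathbb{Q}$ be such that the multisets $\{\pm A_1,\pm A_2,\pm A_3\}$ and $\{\pm B_1,\pm B_2,\pm B_3\}$ have no element in common, and (1) $[A_1,A_2,A_3]=^3_2[B_1,B_2,B_3]$, (2) $A_1^4+A_2^4+A_3^4=B_1^4+B_2^4+B_3^4$, (3) $A_1+A_2+A_3=B_1+B_2+B_3=0$. Then $[\pm(A_1,A_2,A_3),\pm(A_2,A_3,A_1),\pm(A_3,A_1,A_2)]=^6_5[\pm(B_1,B_2,B_3),\pm(B_2,B_3,B_1),\pm(B_3,B_1,B_2)]$, i.e. these two multisets of six vectors in $\mathbb{Q}^3$ form a $\mathrm{PTE}_3$ solution of degree $5$ and size $6$.
   Context: For multisets $A=\{\mathbf{a}_1,\ldots,\mathbf{a}_n\}$, $B=\{\mathbf{b}_1,\ldots,\mathbf{b}_n\}\subset\mathbb{Q}^r$ with $\mathbf{a}_i=(a_{i1},\ldots,a_{ir})$, $\mathbf{b}_i=(b_{i1},\ldots,b_{ir})$, $[A]=^n_m[B]$ (a $\mathrm{PTE}_r$ solution of degree $m$ and size $n$) means $A,B$ have no common element and $\sum_i\prod_j a_{ij}^{k_j}=\sum_i\prod_j b_{ij}^{k_j}$ for all nonnegative integers $k_j$ with $1\le\sum_jk_j\le m$; for $r=1$ this reads $\sum_i a_i^k=\sum_i b_i^k$ for $1\le k\le m$. The notation $\pm\mathbf{v}$ in a multiset lists both $\mathbf{v}$ and $-\mathbf{v}$. *)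

(* Defs.v *)
From HB Require Import structures.
From mathcomp Require Import all_boot all_order all_algebra.
Set Implicit Arguments.
Unset Strict Implicit.
Unset Printing Implicit Defensive.
Import Order.TTheory GRing.Theory Num.Theory.
Local Open Scope ring_scope.

(* A multiset of size n is represented by an n-tuple listing its elements with
   multiplicity; the predicates below do not depend on the order of the list. *)

Definition no_common_element (T : eqType) (n : nat) (A B : n.-tuple T) : Prop :=
  forall x : T, x \in A -> x \notin B.

(* [A] =^n_m [B] for multisets A, B of vectors in Q^r. *)
Definition PTE (r n m : nat) (A B : n.-tuple 'rV[rat]_r) : Prop :=
  no_common_element A B /\
  forall k : 'I_r -> nat, (1 <= \sum_(j < r) k j <= m)%N ->
    \sum_(i < n) \prod_(j < r) tnth A i ord0 j ^+ k j =
    \sum_(i < n) \prod_(j < r) tnth B i ord0 j ^+ k j.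

(* The case r = 1, a rational number a being identified with the vector (a). *)
Definition PTE1 (n m : nat) (A B : n.-tuple rat) : Prop :=
  PTE m [tuple of map (fun a : rat => const_mx a : 'rV[rat]_1) A]
        [tuple of map (fun b : rat => const_mx b : 'rV[rat]_1) B].

Definition vec3 (x y z : rat) : 'rV[rat]_3 :=
  \row_(j < 3) tnth [tuple x; y; z] j.

(* The multiset {±x, ±y, ±z}. *)
Definition pm3 (V : zmodType) (x y z : V) : 6.-tuple V :=
  [tuple x; - x; y; - y; z; - z].

(* Main.v *)
Require Import Defs.
From HB Require Import structures.
From mathcomp Require Import all_boot all_order all_algebra.
From mathcomp Require Import ring zify.
Set Implicit Arguments.
Unset Strict Implicit.
Unset Printing Implicit Defensive.
Import Order.TTheory GRing.Theory Num.Theory.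
Local Open Scope ring_scope.

(** Opposite vectors cancel in the moments of odd degree.  On the plane
    [x + y + z = 0], put [u = x + w y + w^2 z] and [v = x + w^2 y + w z] with [w]
    a primitive cube root of unity: the cyclic shift multiplies [u] and [v] by
    inverse cube roots of unity, so the only invariant monomials [u^i v^j] of
    degree 2 and 4 are [u v] and [(u v)^2].  Hence every cyclic moment of degree
    2 or 4 is a constant times a power of [x^2 + x y + y^2], which is half the
    sum of squares and so takes the same value on both sides. *)

Definition cyclic_moment (R : comPzRingType) (a b c : nat) (x y z : R) : R :=
  x ^+ a * y ^+ b * z ^+ c + y ^+ a * z ^+ b * x ^+ c + z ^+ a * x ^+ b * y ^+ c.

Lemma cyclic_moment2 (R : comPzRingType) (a b c : nat) : (a + b + c = 2)%N ->
  exists k : R, forall x y : R,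
    cyclic_moment a b c x y (- x - y) = k * (x ^+ 2 + x * y + y ^+ 2).
Proof.
rewrite /cyclic_moment.
case: a => [|[|[|a]]]; case: b => [|[|[|b]]]; case: c => [|[|[|c]]] //= _;
  (* The form equals 1 at [x = 1], [y = -1], so [k] is the moment there: 2 for a square, -1 for a
     mixed product. *)
  solve [exists 2 => x y; ring | exists (-1) => x y; ring].
Qed.

Lemma cyclic_moment4 (R : comPzRingType) (a b c : nat) : (a + b + c = 4)%N ->
  exists k : R, forall x y : R,
    cyclic_moment a b c x y (- x - y) = k * (x ^+ 2 + x * y + y ^+ 2) ^+ 2.
Proof.
rewrite /cyclic_moment.
case: a => [|[|[|[|[|a]]]]]; case: b => [|[|[|[|[|b]]]]];
  case: c => [|[|[|[|[|c]]]]] //= _;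
  (* By the same evaluation: 2 for type x^4, -1 for x^3 y, 1 for x^2 y^2, and 0 for x^2 y z, whose
     moment has the factor x + y + z. *)
  solve [exists 2 => x y; ring | exists (-1) => x y; ring
        | exists 1 => x y; ring | exists 0 => x y; ring].
Qed.

(** Opposite vectors give monomials differing by the sign (-1)^degree; this yields the first factor,
    which vanishes in odd degree. *)
Lemma moment_pm3 (x y z : rat) (k : 'I_3 -> nat) :
  \sum_(i < 6) \prod_(j < 3)
     tnth (pm3 (vec3 x y z) (vec3 y z x) (vec3 z x y)) i ord0 j ^+ k j =
  (1 + (-1) ^+ (\sum_(j < 3) k j)) *
  cyclic_moment (k 0) (k 1) (k 2%:R) x y z.
Proof.
have e1 : lift ord0 (ord0 : 'I_2) = 1 :> 'I_3 by apply/val_inj.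
have e2 : lift ord0 (lift ord0 (ord0 : 'I_1)) = 2%:R :> 'I_3 by apply/val_inj.
rewrite !big_ord_recl !big_ord0 !(tnth_nth 0) /= !mxE /= !(tnth_nth 0) /=.
rewrite e1 e2 /cyclic_moment.
move: (k ord0) (k 1) (k 2%:R) => a b c.
rewrite addn0 !addr0 !mulr1 !exprD ![(- x) ^+ _]exprNn ![(- y) ^+ _]exprNn.
rewrite ![(- z) ^+ _]exprNn.
move: ((-1) ^+ a) ((-1) ^+ b) ((-1) ^+ c) => sa sb sc.
ring.
Qed.

(** Reduces disjointness of the vector multisets to that of the scalar ones, through first
    coordinates. *)
Lemma mem_pm3_vec3 (x y z : rat) (v : 'rV[rat]_3) :
  v \in pm3 (vec3 x y z) (vec3 y z x) (vec3 z x y) ->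
  v ord0 ord0 \in pm3 x y z.
Proof.
move=> /(map_f (fun w : 'rV[rat]_3 => w ord0 ord0)).
by rewrite /= !mxE !(tnth_nth 0).
Qed.

Lemma PTE1_sum_squares (A1 A2 A3 B1 B2 B3 : rat) :
  PTE1 2 [tuple A1; A2; A3] [tuple B1; B2; B3] ->
  A1 ^+ 2 + A2 ^+ 2 + A3 ^+ 2 = B1 ^+ 2 + B2 ^+ 2 + B3 ^+ 2.
Proof.
case=> _ /(_ (fun=> 2)); rewrite big_ord1 => /(_ isT).
rewrite !big_ord_recl !big_ord0 !(tnth_nth 0) /= !mxE !mulr1.
by rewrite !addr0 !addrA.
Qed.

Theorem theorem5p6 (A1 A2 A3 B1 B2 B3 : rat)
  (hdisj : no_common_element (pm3 A1 A2 A3) (pm3 B1 B2 B3))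
  (h1 : PTE1 2 [tuple A1; A2; A3] [tuple B1; B2; B3])
  (h2 : A1 ^+ 4 + A2 ^+ 4 + A3 ^+ 4 = B1 ^+ 4 + B2 ^+ 4 + B3 ^+ 4)
  (h3A : A1 + A2 + A3 = 0)
  (h3B : B1 + B2 + B3 = 0) :
  PTE 5 (pm3 (vec3 A1 A2 A3) (vec3 A2 A3 A1) (vec3 A3 A1 A2))
        (pm3 (vec3 B1 B2 B3) (vec3 B2 B3 B1) (vec3 B3 B1 B2)).
Proof.
split=> [v /mem_pm3_vec3 vA | k].
  by apply/negP => /mem_pm3_vec3 vB; move: (hdisj _ vA); rewrite vB.
rewrite !moment_pm3.
have -> : (\sum_(j < 3) k j)%N = (k 0%R + k 1%R + k 2%:R%R)%N.
  by rewrite !big_ord_recl big_ord0 addn0 addnA; congr (k _ + k _ + k _)%N;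
     apply/val_inj.
have eqA : A3 = - A1 - A2 by rewrite -[RHS]add0r -h3A; ring.
have eqB : B3 = - B1 - B2 by rewrite -[RHS]add0r -h3B; ring.
have eq_p : A1 ^+ 2 + A1 * A2 + A2 ^+ 2 = B1 ^+ 2 + B1 * B2 + B2 ^+ 2.
  have := PTE1_sum_squares h1; rewrite eqA eqB => hs.
  (* With the third entry eliminated, each sum of squares is twice the form. *)
  apply: (@mulfI _ (2 : rat)) => //.
  by apply: etrans (etrans hs _); ring.
rewrite eqA eqB; set d := (k 0%R + k 1%R + k 2%:R%R)%N => d_le.
have [od|ev] := boolP (odd d); first by rewrite -signr_odd od subrr !mul0r.
(* The only even degrees from 1 to 5. The constant [c] depends on the exponents alone, so both sides
   share it. *)
congr (_ * _); have [d2|d4] : d = 2 \/ d = 4 by lia.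
  by have [c hc] := cyclic_moment2 rat d2; rewrite !hc eq_p.
by have [c hc] := cyclic_moment4 rat d4; rewrite !hc eq_p.
Qed.
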